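(* Let $d\ge 2$ and let $u$ be an Arnoux-Rauzy word over the $d$-letter alphabet $\mathcal A=\{0,1,\dots,d-1\}$. Then $u$ has the property $\mathcal P_{\mathrm{Fact}(u)}$; equivalently, $u$ has the WELLDOC property.
   Context: Words: $\mathcal A^*$ is the set of finite words over $\mathcal A$; $\varepsilon$ is the empty word. An infinite word $u=u_0u_1u_2\cdots$ is an infinite sequence of letters. It is aperiodic if it is not of the form $vw^\omega$ with $v,w$ finite words, $w$ nonempty. A finite word $w$ is a factor of $u$ if $w=u_i\cdots u_{i+|w|-1}$ for some $i$; each such $i$ is an occurrence of $w$. $\mathrm{Fact}(u)$ is the set of (finite) factors and $\mathrm{Pref}(u)$ the set of (finite) prefixes of $u$; $\mathrm{Pref}_n u$ is the prefix of length $n$. $|v|_a$ is the number of occurrences of the letter $a$ in $v$, and the Parikh vector of $v$ is $(|v|_0,\dots,|v|_{d-1})$. Arnoux-Rauzy words: the reversal of a finite word $v=v_1\cdots v_n$ is $\tilde v=v_n\cdots v_1$; $v$ is a palindrome if $\tilde v=v$. The right palindromic closure $v^{(+)}$ is the shortest palindrome having $v$ as a prefix. The iterated palindromic closure $\psi$ is defined by $\psi(\varepsilon)=\varepsilon$ and $\psi(va)=(\psi(v)a)^{(+)}$ for $v\in\mathcal A^*$, $a\in\mathcal A$; for an infinite word $\Delta$, $\psi(\Delta)$ is the infinite word having $\psi(\mathrm{Pref}_n\Delta)$ as a prefix for every $n$. If $\Delta$ is an infinite word over $\mathcal A$ in which every letter of $\mathcal A$ occurs infinitely often, then $c=\psi(\Delta)$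 is a characteristic Arnoux-Rauzy word with directive sequence $\Delta$. An infinite word is an Arnoux-Rauzy word if it has the same set of factors as some characteristic Arnoux-Rauzy word. Property $\mathcal P_X$: for a finite word $v$ let $S_v(u)=\{p\in\mathrm{Pref}(u): pv\in\mathrm{Pref}(u)\}$. For a set $X\subseteq\mathcal A^*$, $u$ has the property $\mathcal P_X$ if for every positive integer $m$, every $v\in X$ and every $\mathbf w\in\mathbb Z_m^d$ there is $p\in S_v(u)$ whose Parikh vector is congruent to $\mathbf w$ modulo $m$. WELLDOC property: an aperiodic infinite word $u$ over $\{0,1,\dots,d-1\}$ has the WELLDOC property if for every positive integer $m$ and every factor $w$ of $u$, denoting by $i_0,i_1,\dots$ the occurrences of $w$ in $u$, one has $$\{(|\mathrm{Pref}_{i_j}u|_0,\dots,|\mathrm{Pref}_{i_j}u|_{d-1})\bmod m : j\in\mathbb N\}=\mathbb Z_m^d.$$ *)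

(* Defs.v *)
From mathcomp Require Import all_boot.

Set Implicit Arguments.
Unset Strict Implicit.
Unset Printing Implicit Defensive.

Section Words.

Variable A : finType.

Definition infword := nat -> A.

Implicit Types (u c Delta : infword) (v w p q : seq A).

Definition Pref_n u n : seq A := mkseq u n.

Definition Pref u p : Prop := exists n, p = Pref_n u n.

Definition occurrence u w (i : nat) : Prop :=
  w = mkseq (fun k => u (i + k)) (size w).

Definition Fact u w : Prop := exists i, occurrence u w i.

(* u = v w^omega, stated pointwise; the default of nth is never reached. *)
Definition eventually_periodic u : Prop :=
  exists v w, w <> [::] /\
    forall n, u n = if n < size v then nth (u n) v n
                    else nth (u n) w ((n - size v) %% size w).

Definition aperiodic u : Prop := ~ eventually_periodic u.

Definition palindrome v : bool := rev v == v.

Definition has_pal_ext v (n : nat) : bool :=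
  [exists p : n.-tuple A, prefix v p && palindrome p].

Lemma has_pal_ext_ex v : exists n, has_pal_ext v n.
Proof.
exists (size (v ++ rev v)); apply/existsP; exists (in_tuple (v ++ rev v)).
by rewrite /= prefix_prefix /palindrome rev_cat revK eqxx.
Qed.

(* A palindrome of minimal length among those having v as a prefix. The default
   branch is never taken, and the palindrome found is the only one of its
   length: see pal_closureP and pal_closure_uniq. *)
Definition pal_closure v : seq A :=
  if [pick p : (ex_minn (has_pal_ext_ex v)).-tuple A
      | prefix v p && palindrome p] is Some p then tval p else v.

Lemma pal_closureP v :
  [/\ prefix v (pal_closure v), palindrome (pal_closure v)
    & forall q, prefix v q -> palindrome q -> size (pal_closure v) <= size q].
Proof.
rewrite /pal_closure; case: ex_minnP => n /existsP[p0 Hp0] nmin.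
case: pickP => [p /andP[vp pp]|/(_ p0)]; last by rewrite Hp0.
split=> // q vq pq; rewrite size_tuple; apply: nmin.
by apply/existsP; exists (in_tuple q); rewrite /= vq pq.
Qed.

Lemma pal_closure_uniq v p :
  prefix v p -> palindrome p ->
  (forall q, prefix v q -> palindrome q -> size p <= size q) ->
  p = pal_closure v.
Proof.
have [vc pc cmin] := pal_closureP v => vp pp pmin.
have szE : size p = size (pal_closure v).
  by apply/eqP; rewrite eqn_leq pmin // cmin.
have le2 : size p <= size v + size v.
  have := pmin (v ++ rev v); rewrite size_cat size_rev; apply.
    exact: prefix_prefix.
  by rewrite /palindrome rev_cat revK.
case: v vp vc pc szE {cmin pmin} le2 => [|x v] vp vc pc szE le2.
  have p0 : size p = 0 by apply/eqP; rewrite -leqn0.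
  by rewrite (size0nil p0) (@size0nil _ (pal_closure [::])) // -szE.
set w := x :: v in vp vc szE pc le2 *; set c := pal_closure w in vc szE pc *.
have nthw r i : prefix w r -> i < size w -> nth x r i = nth x w i.
  by move=> /prefixP[s ->] iw; rewrite nth_cat iw.
apply: (@eq_from_nth _ x) => // i ip.
have [iw|wi] := ltnP i (size w); first by rewrite !nthw.
have jw : size p - i.+1 < size w.
  by rewrite ltn_subLR // (leq_ltn_trans le2) // addSn ltnS leq_add2r.
rewrite -(eqP pp) -(eqP pc) !nth_rev -?szE //.
by rewrite !nthw.
Qed.

(* psi(va) = (psi(v)a)^(+), reading the directive word from left to right. *)
Definition psi v : seq A :=
  foldl (fun p a => pal_closure (rcons p a)) [::] v.

Lemma psi_rcons v a : psi (rcons v a) = pal_closure (rcons (psi v) a).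
Proof. by rewrite /psi foldl_rcons. Qed.

Definition is_psi_inf Delta c : Prop :=
  forall n, Pref c (psi (Pref_n Delta n)).

Definition characteristic_AR c : Prop :=
  exists Delta, (forall a N, exists n, N <= n /\ Delta n = a) /\
    is_psi_inf Delta c.

Definition arnoux_rauzy u : Prop :=
  exists c, characteristic_AR c /\ forall w, Fact u w <-> Fact c w.

Definition parikh v : {ffun A -> nat} := [ffun a => count_mem a v].

(* Residue vectors modulo m > 0 are functions into 'I_m, the residues
   0, ..., m-1; 'Z_m would be wrong for m = 1. *)
Definition parikh_eqmod (m : nat) v (z : {ffun A -> 'I_m}) : Prop :=
  forall a, parikh v a = z a %[mod m].

Definition S_ u v p : Prop := Pref u p /\ Pref u (p ++ v).

Definition property_P (X : seq A -> Prop) u : Prop :=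
  forall (m : nat), 0 < m -> forall v, X v ->
  forall z : {ffun A -> 'I_m}, exists p, S_ u v p /\ parikh_eqmod p z.

(* The vectors Parikh(Pref_i u) mod m always lie in Z_m^d, so equality with
   Z_m^d means that every residue vector is attained. *)
Definition WELLDOC u : Prop :=
  aperiodic u /\
  forall (m : nat), 0 < m -> forall w, Fact u w ->
  forall z : {ffun A -> 'I_m},
    exists i, occurrence u w i /\ parikh_eqmod (Pref_n u i) z.

End Words.

(* Main.v *)
Require Import Defs.
From mathcomp Require Import all_boot zify.
From Stdlib Require Import Classical.

Set Implicit Arguments.
Unset Strict Implicit.
Unset Printing Implicit Defensive.

(** Let c = psi(Delta) be characteristic, let W k = psi(Delta_0 ... Delta_(k-1))
    be its palindromic prefixes, and fix m > 0. Say that a vector f is a shift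
    at level k if some p with p W_k a prefix of c has Parikh vector congruent
    to f modulo m. The shifts at level k decrease with k, and there are only
    finitely many classes modulo m, so from some level K on they form a constant
    set H ([shift_stable]). If p W_k is a prefix of c, it is a prefix of some
    W_l, so every q with q W_l a prefix of c makes q p W_k a prefix of c: thus H
    is closed under addition ([shift_alwaysD]), hence under subtraction modulo m.

    It remains to see that H contains every unit vector. Since W_k is a suffix
    of W_(k+1), the increment h_k = |W_(k+1)| - |W_k| of Parikh vectors is a
    shift at level k, so h_k lies in H for k >= K. The palindromic prefixes of c
    are exactly the W_j, so the longest palindromic suffix of W_k a, where
    a = Delta_k, is a W_j a with j the last index before k such that
    Delta_j = a, or is a itself if a is new; hence |W_(k+1)| is 2|W_k| - |W_j|
    or 2|W_k| + e_a ([W_count_step]). Reading this with k the next occurrence of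
    Delta_j after j gives h_k = h_j + h_(j+1) + ... + h_(k-1) ([W_incr_next]),
    so membership in H goes down from the indices above j to j itself, and all
    h_k, hence all |W_k|, are in H ([shift_always_incr]). At the first occurrence
    k of a, h_k = |W_k| + e_a then gives e_a in H ([shift_alwaysT]).

    So every factor of c, being contained in some W_k, occurs in c after prefixes
    with all residue vectors. A word u with the same factors as c contains a
    prefix of c long enough to exhibit all these occurrences, and what precedes
    it only translates the residues ([factor_parikh_transfer]). Finally, the
    Parikh vectors of the prefixes of an eventually periodic word take at most
    linearly many values modulo m, whereas m ^ d values are needed with d >= 2
    ([all_parikh_aperiodic]). *)

(** * Prefixes of infinite words *)

Section Prefixes.

Variable A : finType.
Implicit Types (u : infword A) (p q v w : seq A).

Lemma size_Pref_n u n : size (Pref_n u n) = n.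
Proof. exact: size_mkseq. Qed.

Lemma Pref_nD u i n :
  Pref_n u (i + n) = Pref_n u i ++ mkseq (fun k => u (i + k)) n.
Proof.
rewrite /Pref_n /mkseq iotaD map_cat add0n -{2}[i]addn0 iotaDl -map_comp.
by congr (_ ++ _); apply: eq_map.
Qed.

Lemma Pref_size u p : Pref u p -> p = Pref_n u (size p).
Proof. by case=> n ->; rewrite size_Pref_n. Qed.

Lemma Pref_catl u p q : Pref u (p ++ q) -> Pref u p.
Proof.
move=> /Pref_size; rewrite size_cat Pref_nD => /eqP.
by rewrite eqseq_cat ?size_Pref_n // => /andP[/eqP -> _]; exists (size p).
Qed.

Lemma Pref_prefix u p q : prefix p q -> Pref u q -> Pref u p.
Proof. by move=> /prefixP[r ->] /Pref_catl. Qed.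

Lemma prefix_Pref u p q :
  Pref u p -> Pref u q -> size p <= size q -> prefix p q.
Proof.
move=> /Pref_size -> /Pref_size ->; rewrite !size_Pref_n => /subnKC <-.
by rewrite Pref_nD prefix_prefix.
Qed.

Lemma occurrence_Pref u v i :
  occurrence u v i <-> Pref u (Pref_n u i ++ v).
Proof.
rewrite /occurrence; split=> [->|/Pref_size].
  by exists (i + size v); rewrite Pref_nD.
rewrite size_cat size_Pref_n Pref_nD => /eqP.
by rewrite eqseq_cat // eqxx /= => /eqP.
Qed.

End Prefixes.

(** * Palindromic closure *)

Section PalindromicClosure.

Variable A : finType.
Implicit Types (p q s t v : seq A).

(** The palindromic closure of t s is t s rev(t), where s is the longest
    palindromic suffix. *)
Lemma pal_closure_split v : v != [::] ->
  exists t s, [/\ v = t ++ s, palindrome s, s != [::],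
    pal_closure v = t ++ s ++ rev t
    & forall t' s', v = t' ++ s' -> palindrome s' -> size s' <= size s].
Proof.
have [/prefixP[r pE] pp pmin] := pal_closureP v => v0.
have min t' s' : v = t' ++ s' -> palindrome s' -> size r <= size t'.
  move=> vE /eqP ps'; have := pmin (t' ++ s' ++ rev t').
  rewrite pE !size_cat size_rev vE size_cat.
  rewrite catA prefix_prefix /palindrome !rev_cat revK ps' -!catA eqxx.
  by rewrite -addnA !leq_add2l; apply.
have rv : size r < size v.
  (* The last letter of v is a nonempty palindromic suffix. *)
  case/lastP: v v0 {pmin pE pp} min => // v x _.
  move=> /(_ v [:: x]); rewrite -cats1 /palindrome eqxx size_cat /=.
  by move=> /(_ erefl isT); lia.
have rE : take (size r) v = rev r.
  have : rev r ++ rev v = v ++ r by rewrite -rev_cat -pE (eqP pp).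
  by move/(congr1 (take (size r))); rewrite take_size_cat ?size_rev // take_cat rv.
have [s vE] : exists s, v = rev r ++ s.
  by exists (drop (size r) v); rewrite -rE cat_take_drop.
have sv : size v = size r + size s by rewrite vE size_cat size_rev.
have cE : pal_closure v = rev r ++ s ++ r by rewrite pE vE catA.
exists (rev r), s; rewrite revK; split=> //.
- move: pp; rewrite cE /palindrome !rev_cat revK -catA.
  by rewrite eqseq_cat // eqxx eqseq_cat ?eqxx ?andbT // size_rev.
- by apply: contraTneq rv => s0; rewrite sv s0 addn0 ltnn.
- move=> t' s' vE' ps'; have := min _ _ vE' ps'.
  by move: sv; rewrite vE' size_cat; lia.
Qed.

End PalindromicClosure.

(** * A uniform bound over a finite type *)

Lemma fin_uniform_bound (T : finType) (Q : T -> nat -> Prop) :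
  (forall t j k, j <= k -> Q t j -> Q t k) -> (forall t, exists k, Q t k) ->
  exists K, forall t, Q t K.
Proof.
move=> Qmon Qex; suff [K QK] : exists K, {in enum T, forall t, Q t K}.
  by exists K => t; apply: QK; rewrite mem_enum.
elim: (enum T) => [|t s [K QK]]; first by exists 0.
have [k Qk] := Qex t; exists (maxn k K) => x; rewrite inE => /predU1P[->|xs].
  exact: Qmon (leq_maxl _ _) Qk.
exact: Qmon (leq_maxr _ _) (QK x xs).
Qed.

(** * Palindromic prefixes of a characteristic word *)

Section CharacteristicWord.

Variables (A : finType) (Delta c : infword A).
Hypothesis psiD : is_psi_inf Delta c.

(** The iterated palindromic closures of the prefixes of Delta. *)
Definition W k := psi (Pref_n Delta k).

Lemma WS k : W k.+1 = pal_closure (rcons (W k) (Delta k)).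
Proof. by rewrite /W /Pref_n mkseqS psi_rcons. Qed.

Lemma W_Pref k : Pref c (W k). Proof. exact: psiD. Qed.

Lemma W_rev k : rev (W k) = W k.
Proof.
case: k => [//|k]; apply/eqP; rewrite WS.
by have [_ + _] := pal_closureP (rcons (W k) (Delta k)).
Qed.

Lemma W_rcons k : prefix (rcons (W k) (Delta k)) (W k.+1).
Proof. by rewrite WS; have [] := pal_closureP (rcons (W k) (Delta k)). Qed.

Lemma W_ltn_size j k : j < k -> size (W j) < size (W k).
Proof.
apply: (homo_ltn (r := fun x y => size (W x) < size (W y))) => {j k} [x y z|k].
  exact: ltn_trans.
by have := size_prefix (W_rcons k); rewrite size_rcons.
Qed.

Lemma W_leq_size j k : j <= k -> size (W j) <= size (W k).
Proof. by rewrite leq_eqVlt => /orP[/eqP->//|/W_ltn_size/ltnW]. Qed.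

Lemma leq_size_W k : k <= size (W k).
Proof. by elim: k => // k IH; apply: leq_ltn_trans IH (W_ltn_size _). Qed.

Lemma W_rcons_prefix j k : j < k -> prefix (rcons (W j) (Delta j)) (W k).
Proof.
move=> jk; apply: prefix_Pref (W_Pref k) _.
  exact: Pref_prefix (W_rcons j) (W_Pref _).
by rewrite size_rcons W_ltn_size.
Qed.

(** Every palindromic prefix of c is some W j: one longer than W k extends
    W k followed by Delta k, so it is at least as long as W k.+1. *)
Lemma pal_Pref_W q : Pref c q -> palindrome q -> exists j, q = W j.
Proof.
move=> cq pq; have ex : exists k, size q <= size (W k).
  by exists (size q); exact: leq_size_W.
case: (ex_minnP ex) => -[|k] qk kmin.
  by exists 0; apply: size0nil; apply/eqP; rewrite -leqn0.
exists k.+1; have kq : size (W k) < size q.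
  by rewrite ltnNge; apply/negP => /kmin; rewrite ltnn.
have vq : prefix (rcons (W k) (Delta k)) q.
  apply: prefix_Pref cq _; last by rewrite size_rcons.
  exact: Pref_prefix (W_rcons k) (W_Pref _).
have [_ _ /(_ q vq pq)] := pal_closureP (rcons (W k) (Delta k)).
rewrite -WS => kq'; rewrite (Pref_size cq) (Pref_size (W_Pref k.+1)).
by congr Pref_n; apply/eqP; rewrite eqn_leq qk.
Qed.

(** The longest palindromic suffix of W k followed by a is a alone when a has not
    occurred in Delta before k, and a (W i) a when i is its last occurrence. *)
Lemma W_count_step k (a := Delta k) :
  (forall i, i < k -> Delta i <> a) /\
    (forall b, count_mem b (W k.+1) = (count_mem b (W k)).*2 + (a == b)) \/
  exists i, [/\ i < k, Delta i = a, forall l, i < l < k -> Delta l <> a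
    & forall b, count_mem b (W k.+1) + count_mem b (W i)
                = (count_mem b (W k)).*2].
Proof.
have := @pal_closure_split A (rcons (W k) a); rewrite -WS.
have -> : rcons (W k) a != [::] by rewrite -size_eq0 size_rcons.
move=> /(_ isT)[t [s [vE ps s0 WE smax]]].
(* Each earlier occurrence i of a yields the palindromic suffix a (W i) a. *)
have long i : i < k -> Delta i = a -> size (W i) + 2 <= size s.
  move=> ik ia; have /prefixP[r] := W_rcons_prefix ik; rewrite ia => kE.
  have kE' : W k = rev r ++ a :: W i by rewrite -W_rev kE rev_cat rev_rcons W_rev.
  have := smax (rev r) (a :: rcons (W i) a); rewrite kE' rcons_cat /=.
  rewrite size_rcons addn2; apply=> //.
  by rewrite /palindrome rev_cons rev_rcons W_rev.
have cnt b : count_mem b (W k.+1) + count_mem b s = (count_mem b (W k) + (a == b)).*2.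
  have := congr1 (count_mem b) vE; rewrite -cats1 count_cat /= addn0 => ->.
  by rewrite WE !count_cat count_rev; lia.
case/lastP: s => // s x in vE ps s0 {WE} smax long cnt *.
have [kE ax] : W k = t ++ s /\ a = x.
  by move: vE; rewrite -rcons_cat => /rcons_inj[].
(* The longest palindromic suffix is a alone, or a q a with q palindromic. *)
case: s => [|y q] in vE ps s0 smax long cnt kE *.
  left; split=> [i ik /(long _ ik)|b]; first by rewrite /=; lia.
  by have := cnt b; rewrite /= -ax; lia.
have [yx pq] : x = y /\ rev q = q.
  by move: ps; rewrite /palindrome rev_rcons rev_cons => /eqP[-> /rcons_inj[]].
rewrite -yx -ax in kE cnt.
(* Reversing W k turns its suffix a q into its prefix q a. *)
have kE' : W k = rcons q a ++ rev t by rewrite -W_rev kE rev_cat rev_cons pq.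
have cqa : Pref c (rcons q a).
  by apply: (@Pref_catl _ _ _ (rev t)); rewrite -kE'; exact: W_Pref.
have [|i qE] := @pal_Pref_W q _ (introT eqP pq).
  by move: cqa; rewrite -cats1 => /Pref_catl.
right; exists i; rewrite qE in kE cnt long cqa *.
have ik : i < k.
  rewrite ltnNge; apply/negP => /W_leq_size.
  by rewrite kE size_cat /=; lia.
split=> // [|l /andP[il lk] /(long _ lk)|b].
- have /Pref_size cq := Pref_prefix (W_rcons i) (W_Pref _).
  move/Pref_size: cqa; rewrite size_rcons.
  by move: cq; rewrite size_rcons => <- /rcons_inj[].
- by have := W_ltn_size il; rewrite /= size_rcons; lia.
- by have := cnt b; rewrite -cats1 /= count_cat /=; lia.
Qed.

Lemma W_suffix k : exists p, W k.+1 = p ++ W k.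
Proof.
have /prefixP[r kE] : prefix (W k) (W k.+1).
  exact: prefix_trans (prefix_rcons _ _) (W_rcons k).
by exists (rev r); rewrite -W_rev kE rev_cat W_rev.
Qed.

(** The increment of Parikh vectors from W k to W k.+1; the truncated
    subtraction is exact by [W_incrE]. *)
Definition W_incr k b := count_mem b (W k.+1) - count_mem b (W k).

Lemma W_incrE k b : count_mem b (W k.+1) = count_mem b (W k) + W_incr k b.
Proof.
rewrite /W_incr subnKC //; have [p ->] := W_suffix k.
by rewrite count_cat leq_addl.
Qed.

Lemma W_count_sum j k b : j <= k ->
  count_mem b (W k) = count_mem b (W j) + \sum_(j <= i < k) W_incr i b.
Proof.
elim: k => [|k IH]; first by rewrite leqn0 => /eqP->; rewrite big_geq.
rewrite leq_eqVlt => /orP[/eqP->|jk]; first by rewrite big_geq ?addn0.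
by rewrite big_nat_recr //= W_incrE IH // addnA.
Qed.

Hypothesis recD : forall a N, exists n, N <= n /\ Delta n = a.

(** The witness k is the next occurrence of the letter Delta j after j. *)
Lemma W_incr_next j : exists2 k, j < k &
  forall b, W_incr k b = W_incr j b + \sum_(j.+1 <= i < k) W_incr i b.
Proof.
have ex : exists k, (j < k) && (Delta k == Delta j).
  by have [k [jk kE]] := recD (Delta j) j.+1; exists k; rewrite jk kE eqxx.
case: (ex_minnP ex) => k /andP[jk /eqP kE] kmin; exists k => // b.
have [[+ _]|[i [ik iE inext cnt]]] := W_count_step k.
  by move=> /(_ j jk); rewrite kE.
have ij : i = j.
  case: (ltngtP i j) => // lt; first by case: (inext j); rewrite ?lt ?kE.
  by have := kmin i; rewrite lt iE kE eqxx leqNgt ik => /(_ isT).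
have := cnt b; rewrite W_incrE ij (@W_count_sum j k b (ltnW jk)) big_ltn //.
by lia.
Qed.

(** The witness k is the first occurrence of a in Delta. *)
Lemma W_incr_first a : exists k, forall b, W_incr k b = count_mem b (W k) + (a == b).
Proof.
have ex : exists k, Delta k == a.
  by have [k [_ kE]] := recD a 0; exists k; rewrite kE.
case: (ex_minnP ex) => k /eqP kE kmin; exists k => b.
have [[_ /(_ b)]|[i [ik iE _ _]]] := W_count_step k.
  by rewrite W_incrE kE; lia.
by have := kmin i; rewrite iE kE eqxx leqNgt ik => /(_ isT).
Qed.

(** * Residues of the prefixes of a characteristic word *)

Variable m : nat.
Hypothesis m_gt0 : 0 < m.
Implicit Types (f g : A -> nat).

(** Some prefix of c followed by W k has Parikh vector f modulo m. Vectors are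
    functions into nat, considered up to congruence. *)
Definition shift_at k f := exists p, Pref c (p ++ W k) /\
  forall b, count_mem b p = f b %[mod m].

(** The intersection of these sets of shifts over all levels; it is
    closed under addition, and [shift_alwaysT] shows that it contains everything. *)
Definition shift_always f := forall k, shift_at k f.

Lemma shift_at_eq k f g : (forall b, f b = g b %[mod m]) ->
  shift_at k f -> shift_at k g.
Proof. by move=> fg [p [cp pf]]; exists p; split=> // b; rewrite pf. Qed.

Lemma shift_at_leq j k f : j <= k -> shift_at k f -> shift_at j f.
Proof.
move=> jk [p [cp pf]]; exists p; split=> //; apply: Pref_prefix cp.
have /prefixP[r ->] := prefix_Pref (W_Pref j) (W_Pref k) (W_leq_size jk).
by rewrite catA prefix_prefix.
Qed.

Lemma shift_always_eq f g : (forall b, f b = g b %[mod m]) ->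
  shift_always f -> shift_always g.
Proof. by move=> fg hf k; apply: shift_at_eq fg _. Qed.

Lemma shift_always0 : shift_always (fun=> 0).
Proof. by move=> k; exists [::]; split=> //; exact: W_Pref. Qed.

Lemma shift_alwaysD f g : shift_always f -> shift_always g ->
  shift_always (fun b => f b + g b).
Proof.
move=> hf hg k; have [p [cp pf]] := hf k.
have /prefixP[r rE] := prefix_Pref cp (W_Pref _) (leq_size_W (size (p ++ W k))).
have [q [cq qg]] := hg (size (p ++ W k)); exists (q ++ p); split.
  by move: cq; rewrite rE !catA => /Pref_catl.
by move=> b; rewrite count_cat addnC -modnDm pf qg modnDm.
Qed.

Lemma shift_alwaysM n f : shift_always f -> shift_always (fun b => n * f b).
Proof.
move=> hf; elim: n => [|n IH]; first exact: shift_always_eq shift_always0.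
by apply: shift_always_eq (shift_alwaysD hf IH) => b; rewrite mulSn.
Qed.

Lemma shift_always_sum (I : eqType) (r : seq I) (F : I -> A -> nat) :
  {in r, forall i, shift_always (F i)} ->
  shift_always (fun b => \sum_(i <- r) F i b).
Proof.
elim: r => [|i r IH] hF.
  by apply: shift_always_eq shift_always0 => b; rewrite big_nil.
have hr : shift_always (fun b => \sum_(i <- r) F i b).
  by apply: IH => x xr; apply: hF; rewrite inE xr orbT.
apply: shift_always_eq (shift_alwaysD (hF i (mem_head _ _)) hr) => b.
by rewrite big_cons.
Qed.

(** Modulo m, the opposite of f is its multiple by m.-1. *)
Lemma shift_always_subl f g : shift_always f ->
  shift_always (fun b => f b + g b) -> shift_always g.
Proof.
move=> hf hfg; apply: shift_always_eq (shift_alwaysD (shift_alwaysM m.-1 hf) hfg).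
by move=> b; rewrite addnA -mulSnr prednK // mulnC modnMDl.
Qed.

(** A decreasing sequence of subsets of the finite set of residue vectors is
    eventually constant. *)
Lemma shift_stable : exists K, forall f, shift_at K f -> shift_always f.
Proof.
pose val_of (z : {ffun A -> 'I_m}) : A -> nat := fun b => z b.
pose Q z k := shift_at k (val_of z) -> shift_always (val_of z).
have [|z|K QK] := @fin_uniform_bound _ Q.
- by move=> z j k jk Qj /(shift_at_leq jk).
- have [[k nk]|nk] := classic (exists k, ~ shift_at k (val_of z)); first by exists k.
  by exists 0 => _ k; apply: NNPP => nzk; apply: nk; exists k.
exists K => f hf; pose z := [ffun b => Ordinal (ltn_pmod (f b) m_gt0)].
have zf b : f b = val_of z b %[mod m] by rewrite /val_of ffunE /= modn_mod.
by apply: (@shift_always_eq (val_of z)) => [b|]; [rewrite zf|apply/QK/(shift_at_eq zf)].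
Qed.

(** Downward induction from the level K at which the shifts are stable. *)
Lemma shift_always_incr k : shift_always (W_incr k).
Proof.
have [K stable] := shift_stable.
suff main n j : K <= j + n -> shift_always (W_incr j).
  by apply: (main K); rewrite leq_addl.
elim: n j => [|n IH] j Kj.
  apply/stable/(@shift_at_leq _ j); first by rewrite -[j]addn0.
  have [p pE] := W_suffix j; exists p; split; first by rewrite -pE; apply: W_Pref.
  by move=> b; rewrite /W_incr pE count_cat addnK.
have later i : j < i -> shift_always (W_incr i).
  by move=> ji; apply: IH; rewrite (leq_trans Kj) // addnS -addSn leq_add2r.
have [l jl lE] := W_incr_next j.
have hs : shift_always (fun b => \sum_(j.+1 <= i < l) W_incr i b).
  by apply: shift_always_sum => i; rewrite mem_index_iota => /andP[/later].
apply: shift_always_subl hs _; apply: shift_always_eq (later l jl) => b.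
by rewrite lE addnC.
Qed.

Lemma shift_alwaysT f : shift_always f.
Proof.
have hW k : shift_always (fun b => count_mem b (W k)).
  have hs := shift_always_sum (fun i (_ : i \in index_iota 0 k) => shift_always_incr i).
  by apply: shift_always_eq hs => b; rewrite (W_count_sum b (leq0n k)).
have he a : shift_always (fun b => a == b).
  have [k kE] := W_incr_first a; apply: shift_always_subl (hW k) _.
  by apply: shift_always_eq (shift_always_incr k) => b; rewrite kE.
have hs := shift_always_sum (fun a (_ : a \in enum A) => shift_alwaysM (f a) (he a)).
apply: shift_always_eq hs => b; congr (_ %% m).
rewrite big_enum (bigD1 b) //= eqxx muln1 big1 ?addn0 // => a /negPf->.
by rewrite muln0.
Qed.

Lemma char_factor_parikh v z : Fact c v ->
  exists i, occurrence c v i /\ @parikh_eqmod A m (Pref_n c i) z.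
Proof.
move=> [i /occurrence_Pref cv]; set x := Pref_n c i in cv.
(* Aim at z minus the Parikh vector of the prefix x before the factor v. *)
have [p [cp pz]] := shift_alwaysT (fun b => z b + m.-1 * count_mem b x) (size (x ++ v)).
have /prefixP[r rE] := prefix_Pref cv (W_Pref _) (leq_size_W (size (x ++ v))).
have cpxv : Pref c ((p ++ x) ++ v).
  by move: cp; rewrite rE !catA => /Pref_catl.
have pxE := Pref_size (Pref_catl cpxv).
exists (size (p ++ x)); rewrite occurrence_Pref -pxE; split=> // b.
rewrite ffunE count_cat -modnDml pz modnDml -addnA -mulSnr prednK //.
by rewrite addnC mulnC modnMDl.
Qed.

End CharacteristicWord.

(** * Transfer between words with the same factors *)

Section Transfer.
Variables (A : finType) (u c : infword A) (m : nat).
Hypotheses (m_gt0 : 0 < m) (uc : forall w, Fact u w <-> Fact c w).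

Lemma factor_parikh_transfer v :
  (forall z, exists i, occurrence c v i /\ @parikh_eqmod A m (Pref_n c i) z) ->
  forall z, exists i, occurrence u v i /\ @parikh_eqmod A m (Pref_n u i) z.
Proof.
move=> cv z.
pose Q (y : {ffun A -> 'I_m}) N := exists p,
  [/\ Pref c (p ++ v), size (p ++ v) <= N & parikh_eqmod p y].
have [y j k jk [p [cp pj py]]|y|N QN] := @fin_uniform_bound _ Q.
- by exists p; split=> //; apply: leq_trans pj jk.
- have [i [/occurrence_Pref ci iy]] := cv y.
  by exists (size (Pref_n c i ++ v)), (Pref_n c i).
have [i /occurrence_Pref] : Fact u (Pref_n c N).
  by apply/uc; exists 0; rewrite /occurrence size_Pref_n.
set s := Pref_n u i => us.
(* The residue z minus the Parikh vector of s. *)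
pose y : {ffun A -> 'I_m} :=
  [ffun b => Ordinal (ltn_pmod (z b + m.-1 * count_mem b s) m_gt0)].
have [p [cp pN py]] := QN y.
have /prefixP[r rE] : prefix (p ++ v) (Pref_n c N).
  by apply: (prefix_Pref cp); [exists N|rewrite size_Pref_n].
have uspv : Pref u ((s ++ p) ++ v).
  by move: us; rewrite rE !catA => /Pref_catl.
have spE := Pref_size (Pref_catl uspv).
exists (size (s ++ p)); rewrite occurrence_Pref -spE; split=> // b.
have := py b; rewrite !ffunE /= modn_mod => pyb.
rewrite count_cat -modnDmr pyb modnDmr addnCA -mulSn prednK //.
by rewrite addnC mulnC modnMDl.
Qed.
End Transfer.

(** * Aperiodicity *)

Section Periodic.
Variables (A : finType) (u : infword A).

Lemma eventually_periodic_bounded_parikh : eventually_periodic u ->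
  exists a b, forall m i, 0 < m -> exists2 j, j < a + b * m &
    forall x, count_mem x (Pref_n u i) = count_mem x (Pref_n u j) %[mod m].
Proof.
move=> [v [w [w0 uE]]]; exists (size v), (size w) => m i m_gt0.
have n_gt0 : 0 < size w by case: w w0 {uE}.
have per k t : size v <= k -> u (k + t * size w) = u k.
  move=> vk; have defE y z l : nth y w (l %% size w) = nth z w (l %% size w).
    by apply: set_nth_default; rewrite ltn_pmod.
  rewrite [RHS]uE [LHS]uE !ltnNge vk (leq_trans vk (leq_addr _ _)) /=.
  by rewrite -addnBAC // [_ - _ + _]addnC modnMDl; apply: defE.
have cntD k t x : size v <= k ->
    count_mem x (Pref_n u (k + t * size w)) =
    count_mem x (Pref_n u k) + t * count_mem x (mkseq (fun l => u (k + l)) (size w)).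
  move=> vk; elim: t => [|t IH]; first by rewrite !mul0n !addn0.
  rewrite mulSnr addnA Pref_nD count_cat IH mulSnr addnA; congr (_ + _).
  congr (count _ _); apply: eq_map => l.
  by rewrite addnAC per // (leq_trans vk) // leq_addr.
have [iv|vi] := ltnP i (size v).
  by exists i => //; apply: leq_trans iv (leq_addr _ _).
have nm0 : 0 < size w * m by rewrite muln_gt0 n_gt0.
set r := (i - size v) %% (size w * m); exists (size v + r).
  by rewrite ltn_add2l ltn_pmod.
move=> x.
have iE : i = size v + r + (i - size v) %/ (size w * m) * m * size w.
  by rewrite -mulnA [m * size w]mulnC -addnA [r + _]addnC -divn_eq subnKC.
rewrite {1}iE cntD ?leq_addr //.
by rewrite mulnAC addnC modnMDl.
Qed.

(** Eventual periodicity would leave at most a + b * m residue vectors for the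
    prefixes, fewer than m ^ 2 for m = a + b + 1. *)
Lemma all_parikh_aperiodic : 1 < #|A| ->
  (forall m, 0 < m -> forall z : {ffun A -> 'I_m},
    exists i, parikh_eqmod (Pref_n u i) z) ->
  aperiodic u.
Proof.
move=> A2 all_z /eventually_periodic_bounded_parikh[a [b ab]].
pose m := (a + b).+1.
have bd (z : {ffun A -> 'I_m}) : exists j : 'I_(a + b * m), parikh_eqmod (Pref_n u j) z.
  have [i iz] := all_z m isT z; have [j jab ij] := ab m i isT.
  by exists (Ordinal jab) => x; rewrite -iz !ffunE ij.
have [f fP] : exists f : {ffun A -> 'I_m} -> 'I_(a + b * m),
    forall z, parikh_eqmod (Pref_n u (f z)) z.
  pose t j (z : {ffun A -> 'I_m}) :=
    [forall x, parikh (Pref_n u j) x == z x %[mod m]].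
  have ext z : exists j : 'I_(a + b * m), t j z.
    by have [j jz] := bd z; exists j; apply/forallP => x; apply/eqP/jz.
  exists (fun z => xchoose (ext z)) => z x.
  by have /forallP/(_ x)/eqP := xchooseP (ext z).
have f_inj : injective f.
  move=> y z fyz; apply/ffunP => x; apply: val_inj.
  by have := fP y x; rewrite fyz (fP z x) !modn_small.
have := leq_card f f_inj; rewrite card_ffun !card_ord leqNgt => /negP; apply.
apply: (@leq_trans (m ^ 2)); last by rewrite leq_pexp2l.
by rewrite /m; nia.
Qed.
End Periodic.

(** * Arnoux-Rauzy words *)

Lemma AR_factor_parikh (A : finType) (u : infword A) (m : nat) v z :
  arnoux_rauzy u -> 0 < m -> Fact u v ->
  exists i, occurrence u v i /\ @parikh_eqmod A m (Pref_n u i) z.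
Proof.
move=> [c [[Delta [recD psiD]] uc]] m_gt0 uv.
apply: (factor_parikh_transfer m_gt0 uc) => y.
by apply: (char_factor_parikh psiD recD) => //; apply/uc.
Qed.

Theorem theorem4p13 (d : nat) (hd : 2 <= d) (u : infword 'I_d)
    (hu : arnoux_rauzy u) :
  property_P (Fact u) u /\ WELLDOC u.
Proof.
split=> [m m_gt0 v uv z|].
  have [i [/occurrence_Pref ui iz]] := AR_factor_parikh z hu m_gt0 uv.
  by exists (Pref_n u i); split=> //; split=> //; exists i.
split=> [|m m_gt0 w uw z]; last exact: AR_factor_parikh.
apply: all_parikh_aperiodic => [|m m_gt0 z]; first by rewrite card_ord.
have u0 : Fact u [::] by exists 0.
by have [i [_ iz]] := AR_factor_parikh z hu m_gt0 u0; exists i.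
Qed.
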